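(* Let $\mathcal{A}$ and $\mathfrak{A}$ be Banach algebras such that $\mathcal{A}$ is a Banach $\mathfrak{A}$-bimodule with compatible actions. Assume that $\mathfrak{A}$ acts on $\mathcal{A}$ trivially from the left and that $\mathcal{A}/J$ has a left identity. If $\mathcal{A}$ is biflat, then $\mathcal{A}$ is module biflat (as an $\mathfrak{A}$-module).
   Context: Compatible actions: $\alpha\cdot(ab)=(\alpha\cdot a)b$ and $(ab)\cdot\alpha=a(b\cdot\alpha)$ for $a,b\in\mathcal{A}$, $\alpha\in\mathfrak{A}$. $\mathfrak{A}$ acts trivially on $\mathcal{A}$ from the left if there is a continuous linear functional $f$ on $\mathfrak{A}$ with $\alpha\cdot a=f(\alpha)a$ for all $\alpha\in\mathfrak{A}$, $a\in\mathcal{A}$. The projective tensor product $\mathcal{A}\widehat{\bigotimes}\mathcal{A}$ is a Banach algebra with $(a\otimes b)(c\otimes d)=ac\otimes bd$, and carries the canonical actions $a\cdot(b\otimes c)=ab\otimes c$, $(b\otimes c)\cdot a=b\otimes ca$, $\alpha\cdot(b\otimes c)=(\alpha\cdot b)\otimes c$, $(b\otimes c)\cdot\alpha=b\otimes(c\cdot\alpha)$. Let $I$ be the closed ideal of $\mathcal{A}\widehat{\bigotimes}\mathcal{A}$ generated by the elements $\alpha\cdot a\otimes b-a\otimes b\cdot\alpha$ ($\alpha\in\mathfrak{A}$, $a,b\in\mathcal{A}$). Let $\omega:\mathcal{A}\widehat{\bigotimes}\mathcal{A}\to\mathcal{A}$ be the bounded linear map with $\omega(a\otimes b)=ab$, and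 let $J$ be the closed ideal of $\mathcal{A}$ generated by $\omega(I)$ (that is, by the elements $\alpha\cdot(ab)-(ab)\cdot\alpha$). The quotients $(\mathcal{A}\widehat{\bigotimes}\mathcal{A})/I$ and $\mathcal{A}/J$ carry the induced actions of $\mathfrak{A}$ and $\mathcal{A}$. Let $\widetilde{\omega}:(\mathcal{A}\widehat{\bigotimes}\mathcal{A})/I\to\mathcal{A}/J$ be the induced map, $\widetilde{\omega}(a\otimes b+I)=ab+J$, and let $\omega^*$, $\widetilde{\omega}^*$ denote the Banach space adjoints. Dual spaces carry the dual actions $\langle\alpha\cdot\phi,x\rangle=\langle\phi,x\cdot\alpha\rangle$, $\langle a\cdot\phi,x\rangle=\langle\phi,x\cdot a\rangle$, and similarly for the right actions. An $\mathcal{A}/J$-$\mathfrak{A}$-module morphism $\varphi:X\to Y$ is a norm-continuous additive map (not assumed $\mathbb{C}$-linear) with $\varphi(\alpha\cdot x)=\alpha\cdot\varphi(x)$, $\varphi(x\cdot\alpha)=\varphi(x)\cdot\alpha$ for $\alpha\in\mathfrak{A}$, and commuting with the left and right actions of $\mathcal{A}/J$, where $a+J$ acts as $a\in\mathcal{A}$ does (i.e. $\varphi(a\cdot x)=a\cdot\varphi(x)$ and $\varphi(x\cdot a)=\varphi(x)\cdot a$ for $a\in\mathcal{A}$). $\mathcal{A}$ is biflat if $\omega^*$ has a bounded left inverse which is an $\mathcal{A}$-bimodule homomorphism. $\mathcal{A}$ is module biflat (as an $\mathfrak{A}$-module) if $\widetilde{\omega}^*$ has a bounded left inverse which is an $\mathcal{A}/J$-$\mathfrak{A}$-module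 morphism. *)

(* Defs.v *)
From HB Require Import structures.
From mathcomp Require Import all_boot all_order all_algebra.
From mathcomp Require Import ring_quotient complex ring.
From mathcomp Require Import all_classical all_reals.
From mathcomp Require Import topology normedtype.

Set Implicit Arguments.
Unset Strict Implicit.
Unset Printing Implicit Defensive.

Import Order.TTheory GRing.Theory Num.Theory.
Import numFieldTopology.Exports numFieldNormedType.Exports.

Local Open Scope classical_set_scope.
Local Open Scope ring_scope.
Local Open Scope complex_scope.

Section RealNorm.
Context {R : realType}.
Implicit Types r s : R.

Definition of_real r : R[i] := r%:C.

Lemma of_real0 : of_real 0 = 0. Proof. by []. Qed.

Lemma of_realD r s : of_real (r + s) = of_real r + of_real s.
Proof. exact: (rmorphD (real_complex R)). Qed.

Lemma of_realM r s : of_real (r * s) = of_real r * of_real s.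
Proof. exact: (rmorphM (real_complex R)). Qed.

Lemma ler_of_real r s : (of_real r <= of_real s) = (r <= s).
Proof. exact: lecR. Qed.

Lemma of_real_ge0 r : (0 <= of_real r) = (0 <= r).
Proof. exact: ler0c. Qed.

Lemma of_real_inj : injective of_real.
Proof. by move=> r s []. Qed.

Lemma of_real_Re (z : R[i]) : z \is Num.real -> of_real (complex.Re z) = z.
Proof. exact: RRe_real. Qed.

Lemma of_real_real r : of_real r \is Num.real.
Proof. by rewrite realE !lecE/= eqxx /= le_total. Qed.

Context {X : normedModType R[i]}.
Implicit Types x y : X.

(* The norms of the library are valued in the scalars, here R[i]. *)
Definition rnorm x : R := complex.Re `|x|.

Lemma rnormE x : `|x| = of_real (rnorm x).
Proof. by rewrite of_real_Re// normr_real. Qed.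

Lemma rnorm_ge0 x : 0 <= rnorm x.
Proof. by rewrite -of_real_ge0 -rnormE. Qed.

Lemma rnormD x y : rnorm (x + y) <= rnorm x + rnorm y.
Proof. by rewrite -ler_of_real of_realD -!rnormE ler_normD. Qed.

Lemma rnormZ (k : R[i]) x : rnorm (k *: x) = complex.Re `|k| * rnorm x.
Proof.
apply: of_real_inj.
by rewrite of_realM -!rnormE normrZ of_real_Re// normr_real.
Qed.

Lemma rnorm0 : rnorm 0 = 0.
Proof. by rewrite /rnorm normr0. Qed.

Lemma rnorm0_eq0 x : rnorm x = 0 -> x = 0.
Proof. by move=> x0; apply/normr0_eq0; rewrite rnormE x0. Qed.

Lemma rnorm_opp x : rnorm (- x) = rnorm x.
Proof. by rewrite /rnorm normrN. Qed.

End RealNorm.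

(* Bounded (that is, continuous) linear maps, with the operator norm. *)
Section BoundedLinear.
Context {R : realType}.
Local Notation C := R[i].
Context (X Y : normedModType C).

Definition blin_pred : {pred X -> Y} :=
  fun f => `[< linear f /\ continuous f >].

Record blin := Blin { blin_fun :> X -> Y ; blin_subproof : blin_fun \in blin_pred }.

HB.instance Definition _ := [isSub for blin_fun].
HB.instance Definition _ := [Choice of blin by <:].

Lemma blin_pred_submod : submod_closed blin_pred.
Proof.
split; first apply/asboolP; first split.
- by move=> k x y /=; rewrite scaler0 addr0.
- by move=> x; exact: cvg_cst.
move=> k f g /asboolP[lf cf] /asboolP[lg cg]; apply/asboolP; split.
  move=> a x y /=.
  rewrite !(fctE)/= lf lg !scalerDr !scalerA (mulrC k a).
  by rewrite addrACA.
by move=> x; apply: cvgD; [apply: cvgZr; exact: cf|exact: cg].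
Qed.
HB.instance Definition _ :=
  GRing.isSubmodClosed.Build C (X -> Y) blin_pred blin_pred_submod.
HB.instance Definition _ := [SubChoice_isSubLmodule of blin by <:].

Implicit Types f g : blin.

Lemma blin_linear f : linear f.
Proof. by case: f => f /= /asboolP[]. Qed.

HB.instance Definition _ f :=
  GRing.isLinear.Build C X Y *:%R (blin_fun f) (blin_linear f).

Lemma blin_continuous f : continuous f.
Proof. by case: f => f /= /asboolP[]. Qed.

Lemma blin_eqP f g : f =1 g -> f = g.
Proof. by move=> fg; apply: val_inj; apply/funext. Qed.

End BoundedLinear.

Section OperatorNorm.
Context {R : realType}.
Local Notation C := R[i].
Context (X Y : normedModType C).
Implicit Types f g : blin X Y.

Lemma blin_bounded f :
  exists2 M : R, 0 <= M & forall x, rnorm (f x) <= M * rnorm x.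
Proof.
have /linear_bounded_continuous/linear_boundedP := @blin_continuous _ _ _ f.
case/pinfty_ex_gt0 => r r0 fr.
have rE : r = of_real (complex.Re r) by rewrite of_real_Re// gtr0_real.
exists (complex.Re r); first by rewrite -of_real_ge0 -rE ltW.
by move=> x; rewrite -ler_of_real of_realM -!rnormE -rE; exact: fr.
Qed.

Lemma is_blin (f : X -> Y) (M : R) : linear f ->
  (forall x, rnorm (f x) <= M * rnorm x) -> f \in @blin_pred _ X Y.
Proof.
move=> lf fM; apply/asboolP; split => //.
pose l := GRing.isLinear.Build C X Y *:%R f lf.
pose F : {linear X -> Y} := HB.pack f l.
apply: (@bounded_linear_continuous _ _ _ F); apply/linear_boundedP.
exists (of_real M); split; first exact: of_real_real.
move=> r Mr x; rewrite rnormE/= (le_trans (y := of_real (M * rnorm x)))//.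
  by rewrite ler_of_real fM.
by rewrite of_realM -rnormE ler_wpM2r// ltW.
Qed.

Definition opnorm f : R := sup [set rnorm (f x) | x in [set x | `|x| <= 1]].

Lemma opnorm_has_sup f : has_sup [set rnorm (f x) | x in [set x | `|x| <= 1]].
Proof.
split; first by exists (rnorm (f 0)), 0 => //=; rewrite normr0.
have [M M0 fM] := blin_bounded f; exists M => _ [x /= x1 <-].
rewrite (le_trans (fM x))// ler_piMr//.
by rewrite -ler_of_real -rnormE.
Qed.

Lemma opnorm_ge0 f : 0 <= opnorm f.
Proof.
apply: (@le_trans _ _ (rnorm (f 0))); first exact: rnorm_ge0.
apply: ub_le_sup; first by case: (opnorm_has_sup f).
by exists 0 => //=; rewrite normr0.
Qed.

Lemma opnorm_bound f x : rnorm (f x) <= opnorm f * rnorm x.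
Proof.
have [/rnorm0_eq0 ->|x0] := eqVneq (rnorm x) 0.
  by rewrite (linear0 f) !rnorm0 mulr0.
have x_gt0 : 0 < rnorm x by rewrite lt_neqAle eq_sym x0 rnorm_ge0.
rewrite -ler_pdivrMr// mulrC.
have ReV : complex.Re `|of_real (rnorm x)^-1| = (rnorm x)^-1.
  by rewrite ger0_norm// of_real_ge0 invr_ge0 ltW.
rewrite -{1}ReV -rnormZ -linearZ.
apply: ub_le_sup; first by case: (opnorm_has_sup f).
exists (of_real (rnorm x)^-1 *: x) => //=.
by rewrite rnormE rnormZ ReV mulVf.
Qed.

Lemma opnorm_le f M : 0 <= M -> (forall x, rnorm (f x) <= M * rnorm x) ->
  opnorm f <= M.
Proof.
move=> M0 fM; apply: ge_sup; first by case: (opnorm_has_sup f).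
move=> _ [x /= x1 <-]; rewrite (le_trans (fM x))// ler_piMr//.
by rewrite -ler_of_real -rnormE.
Qed.

Let norm f : C := of_real (opnorm f).

Let ler_normD f g : norm (f + g) <= norm f + norm g.
Proof.
rewrite -of_realD ler_of_real; apply: opnorm_le => [|x].
  by rewrite addr_ge0 ?opnorm_ge0.
rewrite (le_trans (rnormD _ _))// mulrDl lerD ?opnorm_bound//.
Qed.

Let norm_scale_le (k : C) f : opnorm (k *: f) <= complex.Re `|k| * opnorm f.
Proof.
have k0 : 0 <= complex.Re `|k| by rewrite -of_real_ge0 of_real_Re ?normr_real.
apply: opnorm_le => [|x]; first by rewrite mulr_ge0 ?opnorm_ge0.
by rewrite /= rnormZ -mulrA ler_wpM2l ?opnorm_bound.
Qed.

Let normrZ (k : C) f : norm (k *: f) = `|k| * norm f.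
Proof.
have kE (z : C) : `|z| = of_real (complex.Re `|z|).
  by rewrite of_real_Re ?normr_real.
apply/eqP; rewrite eq_le; apply/andP; split.
  by rewrite [`|k|]kE -of_realM ler_of_real norm_scale_le.
have [->|k0] := eqVneq k 0.
  by rewrite normr0 mul0r of_real_ge0 opnorm_ge0.
rewrite -ler_pdivlMl ?normr_gt0// -normfV [`|_|]kE -of_realM ler_of_real.
by rewrite -[in leLHS](scalerK k0 f) norm_scale_le.
Qed.

Let normr0_eq0 f : norm f = 0 -> f = 0.
Proof.
move=> /of_real_inj f0; apply: blin_eqP => x; apply: rnorm0_eq0.
by apply: le_anti; rewrite rnorm_ge0 (le_trans (opnorm_bound _ _))// f0 mul0r.
Qed.

HB.instance Definition _ :=
  Lmodule_isNormed.Build C (blin X Y) ler_normD normrZ normr0_eq0.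

Lemma opnormE f : `|f| = of_real (opnorm f).
Proof. by []. Qed.

Lemma rnorm_blin f : rnorm f = opnorm f.
Proof. by []. Qed.

End OperatorNorm.

Definition dual {R : realType} (X : normedModType R[i]) : normedModType R[i] :=
  blin X R[i]^o.

Section BoundedLinearOperations.
Context {R : realType}.
Local Notation C := R[i].

Lemma blin_comp_subproof (X Y Z : normedModType C) (g : blin Y Z) (f : blin X Y) :
  (fun x => g (f x)) \in @blin_pred _ X Z.
Proof.
apply: (@is_blin _ _ _ _ (opnorm g * opnorm f)) => [k x y|x].
  by rewrite !linearP.
rewrite (le_trans (opnorm_bound _ _))// -mulrA ler_wpM2l ?opnorm_ge0//.
exact: opnorm_bound.
Qed.

Definition blin_comp (X Y Z : normedModType C) (g : blin Y Z) (f : blin X Y) :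
  blin X Z := Blin (blin_comp_subproof g f).

Lemma adjoint_subproof (X Y : normedModType C) (f : blin X Y) :
  (fun phi : dual Y => blin_comp phi f : dual X) \in @blin_pred _ (dual Y) (dual X).
Proof.
apply: (@is_blin _ _ _ _ (opnorm f)) => [k phi psi|phi].
  by apply: blin_eqP => x.
rewrite !rnorm_blin; apply: opnorm_le => [|x].
  by rewrite mulr_ge0 ?opnorm_ge0.
rewrite (le_trans (opnorm_bound phi (f x)))// [opnorm f * _]mulrC -mulrA.
by rewrite ler_wpM2l ?opnorm_ge0// opnorm_bound.
Qed.

Definition adjoint (X Y : normedModType C) (f : blin X Y) :
  blin (dual Y) (dual X) := Blin (adjoint_subproof f).

End BoundedLinearOperations.

Section ClosedSubspace.
Context {R : realType} (X : normedModType R[i]).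

Record closed_subspace := ClosedSubspace {
  csub :> X -> Prop ;
  csub0 : csub 0 ;
  csubP : forall (k : R[i]) x y, csub x -> csub y -> csub (k *: x + y) ;
  csub_closed : closed (csub : set X) }.

Definition csub_pred (N : closed_subspace) : {pred X} := fun x => `[< N x >].

Lemma csub_zmod_closed (N : closed_subspace) : zmod_closed (csub_pred N).
Proof.
split; first exact/asboolP/csub0.
move=> x y /asboolP Nx /asboolP Ny; apply/asboolP.
by rewrite addrC -scaleN1r; exact: csubP.
Qed.

HB.instance Definition _ (N : closed_subspace) :=
  GRing.isZmodClosed.Build X (csub_pred N) (csub_zmod_closed N).

End ClosedSubspace.

Section Quotient.
Context {R : realType}.
Local Notation C := R[i].
Context {X : normedModType C} (N : closed_subspace X).

Definition quotient := {ideal_quot csub_pred N}.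

HB.instance Definition _ := GRing.Zmodule.on quotient.
HB.instance Definition _ := EqQuotient.on quotient.

Definition qpi (x : X) : quotient := (\pi_quotient x)%qT.

Lemma qpi_eq x y : qpi x = qpi y <-> N (x - y).
Proof.
rewrite /qpi; split=> [/eqP|Nxy]; last apply/eqP.
  by rewrite -Quotient.idealrBE => /asboolP.
by rewrite -Quotient.idealrBE; apply/asboolP.
Qed.

Lemma qpi_surj Q : exists x, qpi x = Q.
Proof. by exists (repr Q); exact: reprK. Qed.

Lemma qpi_additive x y : qpi (x + y) = qpi x + qpi y.
Proof. exact: Quotient.pi_add. Qed.

Definition qscale (k : C) (Q : quotient) : quotient := qpi (k *: repr Q).

Lemma qpiZ k x : qpi (k *: x) = qscale k (qpi x).
Proof.
apply/qpi_eq; rewrite -scalerBr -[_ *: _]addr0; apply: csubP (csub0 _).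
by apply/qpi_eq/esym/reprK.
Qed.

Let qscaleA a b Q : qscale a (qscale b Q) = qscale (a * b) Q.
Proof. by have [x <-] := qpi_surj Q; rewrite -!qpiZ scalerA. Qed.

Let qscale1 : left_id 1 qscale.
Proof. by move=> Q; have [x <-] := qpi_surj Q; rewrite -!qpiZ scale1r. Qed.

Let qscaleDr : right_distributive qscale +%R.
Proof.
move=> k P Q; have [x <-] := qpi_surj P; have [y <-] := qpi_surj Q.
by rewrite -qpi_additive -!qpiZ -qpi_additive scalerDr.
Qed.

Let qscaleDl Q : {morph qscale^~ Q : a b / a + b}.
Proof.
by move=> a b; have [x <-] := qpi_surj Q; rewrite -!qpiZ -qpi_additive scalerDl.
Qed.

HB.instance Definition _ := GRing.Zmodule_isLmodule.Build C quotient
  qscaleA qscale1 qscaleDr qscaleDl.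

Lemma qpi_linear : linear qpi.
Proof. by move=> k x y; rewrite qpi_additive qpiZ. Qed.

HB.instance Definition _ := GRing.isLinear.Build C X quotient *:%R qpi qpi_linear.

Definition qnorm (Q : quotient) : R := inf [set rnorm x | x in [set x | qpi x = Q]].

Lemma qnorm_has_inf Q : has_inf [set rnorm x | x in [set x | qpi x = Q]].
Proof.
split; last by exists 0 => _ [x _ <-]; exact: rnorm_ge0.
by have [x Qx] := qpi_surj Q; exists (rnorm x), x.
Qed.

Lemma qnorm_ge0 Q : 0 <= qnorm Q.
Proof.
apply: lb_le_inf; first by case: (qnorm_has_inf Q).
by move=> _ [x _ <-]; exact: rnorm_ge0.
Qed.

Lemma qnorm_le x : qnorm (qpi x) <= rnorm x.
Proof. by apply: ge_inf; [case: (qnorm_has_inf (qpi x))|exists x]. Qed.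

Lemma qnorm_lt Q e : 0 < e -> exists2 x, qpi x = Q & rnorm x < qnorm Q + e.
Proof.
move=> e0; have [_ [x Qx <-] xe] := inf_adherent e0 (qnorm_has_inf Q).
by exists x.
Qed.

Let norm Q : C := of_real (qnorm Q).

Let ler_normD P Q : norm (P + Q) <= norm P + norm Q.
Proof.
rewrite -of_realD ler_of_real; apply/ler_addgt0Pr => e e0.
have e20 : 0 < e / 2 by rewrite divr_gt0.
have [x <- xe] := qnorm_lt P e20; have [y <- ye] := qnorm_lt Q e20.
rewrite -linearD (le_trans (qnorm_le _))// (le_trans (rnormD _ _))//.
rewrite (le_trans (lerD (ltW xe) (ltW ye)))// addrACA -splitr//.
Qed.

Let norm_scale_le (k : C) Q : qnorm (k *: Q) <= complex.Re `|k| * qnorm Q.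
Proof.
have k0 : 0 <= complex.Re `|k| by rewrite -of_real_ge0 of_real_Re ?normr_real.
apply/ler_addgt0Pr => e e0.
have e'0 : 0 < e / (complex.Re `|k| + 1) by rewrite divr_gt0// ltr_wpDl.
have [x <- xe] := qnorm_lt Q e'0.
rewrite -linearZ (le_trans (qnorm_le _))// rnormZ.
rewrite (le_trans (ler_wpM2l k0 (ltW xe)))// mulrDr lerD2l.
by rewrite mulrCA ger_pMr// ler_pdivrMr ?ltr_wpDl// mul1r lerDl.
Qed.

Let normrZ (k : C) Q : norm (k *: Q) = `|k| * norm Q.
Proof.
have kE (z : C) : `|z| = of_real (complex.Re `|z|).
  by rewrite of_real_Re ?normr_real.
apply/eqP; rewrite eq_le; apply/andP; split.
  by rewrite [`|k|]kE -of_realM ler_of_real norm_scale_le.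
have [->|k0] := eqVneq k 0.
  by rewrite normr0 mul0r of_real_ge0 qnorm_ge0.
rewrite -ler_pdivlMl ?normr_gt0// -normfV [`|_|]kE -of_realM ler_of_real.
by rewrite -[in leLHS](scalerK k0 Q) norm_scale_le.
Qed.

Let normr0_eq0 Q : norm Q = 0 -> Q = 0.
Proof.
move=> /of_real_inj Q0; have [x Qx] := qpi_surj Q; rewrite -Qx.
rewrite -(linear0 qpi); apply/qpi_eq; rewrite subr0.
apply: (csub_closed (c := N)); move=> B /nbhs_normP[e /= e0 xeB].
have eE : e = of_real (complex.Re e) by rewrite of_real_Re// gtr0_real.
have Re_e0 : 0 < complex.Re e.
  by move: e0; rewrite eE lt_neqAle of_real_ge0 -of_real0 (inj_eq (@of_real_inj R))
    -lt_neqAle.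
have [y Qy] := qnorm_lt Q Re_e0; rewrite Q0 add0r => ye.
exists (x - y); split; first by apply/qpi_eq; rewrite Qx Qy.
by apply: xeB; rewrite /ball_/= subKr rnormE eE ltcR.
Qed.

HB.instance Definition _ :=
  Lmodule_isNormed.Build C quotient ler_normD normrZ normr0_eq0.

Lemma rnorm_quotient (Q : quotient) : rnorm Q = qnorm Q.
Proof. by []. Qed.

End Quotient.

Section QuotientMaps.
Context {R : realType}.
Local Notation C := R[i].

Lemma qproj_subproof (X : normedModType C) (N : closed_subspace X) :
  (@qpi R X N) \in @blin_pred _ X (quotient N).
Proof.
apply: (@is_blin _ _ _ _ 1) => [|x]; first exact: qpi_linear.
by rewrite mul1r rnorm_quotient qnorm_le.
Qed.

Definition qproj (X : normedModType C) (N : closed_subspace X) :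
  blin X (quotient N) := Blin (qproj_subproof N).

Section Factor.
Context (X Y : normedModType C) (N : closed_subspace X) (f : blin X Y).
Hypothesis fN : forall x, N x -> f x = 0.

Definition qlift_fun (Q : quotient N) : Y := f (repr Q).

Lemma qlift_funE x : qlift_fun (qpi N x) = f x.
Proof.
apply/eqP; rewrite -subr_eq0 -linearB; apply/eqP/fN/qpi_eq.
exact: reprK.
Qed.

Lemma qlift_fun_bound (M : R) : 0 <= M ->
  (forall x, rnorm (f x) <= M * rnorm x) ->
  forall Q, rnorm (qlift_fun Q) <= M * rnorm Q.
Proof.
move=> M0 fM Q; rewrite rnorm_quotient; apply/ler_addgt0Pr => e e0.
have e'0 : 0 < e / (M + 1) by rewrite divr_gt0// ltr_wpDl.
have [x <- xe] := qnorm_lt Q e'0.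
rewrite qlift_funE (le_trans (fM x))// (le_trans (ler_wpM2l M0 (ltW xe)))//.
rewrite mulrDr lerD2l mulrCA ger_pMr// ler_pdivrMr ?ltr_wpDl// mul1r lerDl//.
Qed.

Lemma qlift_subproof : qlift_fun \in @blin_pred _ (quotient N) Y.
Proof.
apply: (@is_blin _ _ _ _ (opnorm f)) => [k P Q|].
  have [x <-] := qpi_surj P; have [y <-] := qpi_surj Q.
  by rewrite -linearP !qlift_funE linearP.
apply: qlift_fun_bound; first exact: opnorm_ge0.
exact: opnorm_bound.
Qed.

Definition qlift : blin (quotient N) Y := Blin qlift_subproof.

Lemma qliftE x : qlift (qpi N x) = f x.
Proof. exact: qlift_funE. Qed.

End Factor.

End QuotientMaps.

Section BoundedBilinear.
Context {R : realType}.
Local Notation C := R[i].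

Record bbilin (X Y Z : normedModType C) := BBilin {
  bbilin_fun :> X -> Y -> Z ;
  bbilin_linearl : forall y, linear (bbilin_fun ^~ y) ;
  bbilin_linearr : forall x, linear (bbilin_fun x) ;
  bbilin_bounded : exists2 M : R, 0 <= M &
    forall x y, rnorm (bbilin_fun x y) <= M * (rnorm x * rnorm y) }.

(* The universal property of the projective tensor product: bounded bilinear
   maps into a Banach space factor uniquely through the canonical map, without
   increasing the norm. It determines T up to isometric isomorphism. *)
Record is_projective_tensor (X Y T : completeNormedModType C)
    (tens : bbilin X Y T) : Prop := {
  tens_contraction : forall x y, rnorm (tens x y) <= rnorm x * rnorm y ;
  tens_lift : forall (Z : completeNormedModType C) (B : bbilin X Y Z),
    exists2 L : blin T Z, forall x y, L (tens x y) = B x y &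
      forall M : R, 0 <= M ->
        (forall x y, rnorm (B x y) <= M * (rnorm x * rnorm y)) ->
        opnorm L <= M ;
  tens_uniq : forall (Z : completeNormedModType C) (L L' : blin T Z),
    (forall x y, L (tens x y) = L' (tens x y)) -> L = L' }.

End BoundedBilinear.

(* Banach algebras need not be unital, so they are not library rings. *)
HB.mixin Record isBanachAlgebra (K : numFieldType) V
    & CompleteNormedModule K V := {
  bmul : V -> V -> V ;
  bmulA : associative bmul ;
  bmul_linearl : forall b, linear (bmul ^~ b) ;
  bmul_linearr : forall a, linear (bmul a) ;
  bmul_norm : forall a b, `|bmul a b| <= `|a| * `|b| }.

#[short(type="banachAlgType")]
HB.structure Definition BanachAlgebra (K : numFieldType) :=
  {V of CompleteNormedModule K V & isBanachAlgebra K V}.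

Notation "a ** b" := (bmul a b) (at level 40, left associativity) : ring_scope.

Section BanachAlgebra.
Context {R : realType}.
Local Notation C := R[i].

Lemma rnormM (A : banachAlgType C) (a b : A) :
  rnorm (a ** b) <= rnorm a * rnorm b.
Proof. by rewrite -ler_of_real of_realM -!rnormE; exact: bmul_norm. Qed.

Lemma bmul_bbilin_bounded (A : banachAlgType C) : exists2 M : R, 0 <= M &
  forall a b : A, rnorm (a ** b) <= M * (rnorm a * rnorm b).
Proof. by exists 1 => // a b; rewrite mul1r rnormM. Qed.

Definition bmulB (A : banachAlgType C) : bbilin A A A :=
  BBilin (@bmul_linearl _ A) (@bmul_linearr _ A) (@bmul_bbilin_bounded A).

Definition is_ideal (A : banachAlgType C) (N : closed_subspace A) : Prop :=
  forall a x, N x -> N (a ** x) /\ N (x ** a).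

Section ClosedIdealGen.
Context (A : banachAlgType C) (S : set A).

Definition closed_ideal_gen_set (x : A) : Prop :=
  forall N : closed_subspace A, is_ideal N -> S `<=` N -> N x.

Lemma closed_ideal_gen0 : closed_ideal_gen_set 0.
Proof. by move=> N _ _; exact: csub0. Qed.

Lemma closed_ideal_genP (k : C) x y : closed_ideal_gen_set x ->
  closed_ideal_gen_set y -> closed_ideal_gen_set (k *: x + y).
Proof.
by move=> Sx Sy N NI SN; apply: csubP; [exact: Sx|exact: Sy].
Qed.

Lemma closed_ideal_gen_closed : closed (closed_ideal_gen_set : set A).
Proof.
move=> x clx N NI SN; apply: (csub_closed (c := N)) => B /clx[y [Sy By]].
by exists y; split => //; exact: Sy.
Qed.

(* The closed (two-sided) ideal generated by S. *)
Definition closed_ideal_gen : closed_subspace A :=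
  ClosedSubspace closed_ideal_gen0 closed_ideal_genP closed_ideal_gen_closed.

Lemma closed_ideal_gen_ideal : is_ideal closed_ideal_gen.
Proof.
by move=> a x Sx; split=> N NI SN; have [] := NI a x (Sx N NI SN).
Qed.

Lemma sub_closed_ideal_gen x : S x -> closed_ideal_gen x.
Proof. by move=> Sx N _; exact. Qed.

End ClosedIdealGen.

(* The product of A/N, well defined by qmulE when N is an ideal. *)
Definition qmul (A : banachAlgType C) (N : closed_subspace A)
  (P Q : quotient N) : quotient N := qpi N (repr P ** repr Q).

Lemma bmulBl (A : banachAlgType C) (a b c : A) : (a - b) ** c = a ** c - b ** c.
Proof.
by rewrite addrC -scaleN1r (bmul_linearl c) scaleN1r addrC.
Qed.

Lemma bmulBr (A : banachAlgType C) (a b c : A) : a ** (b - c) = a ** b - a ** c.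
Proof.
by rewrite addrC -scaleN1r (bmul_linearr a) scaleN1r addrC.
Qed.

Lemma qmulE (A : banachAlgType C) (N : closed_subspace A) (a b : A) :
  is_ideal N -> qmul (qpi N a) (qpi N b) = qpi N (a ** b).
Proof.
move=> NI; have reprP (x : A) : N (repr (qpi N x) - x).
  by apply/qpi_eq; exact: reprK.
apply/qpi_eq.
rewrite -[_ - _](subrKA (a ** repr (qpi N b))) -bmulBl -bmulBr -[_ ** _]scale1r.
by apply: csubP; [have [] := NI (repr (qpi N b)) _ (reprP a)
  |have [] := NI a _ (reprP b)].
Qed.

End BanachAlgebra.

Section Bimodule.
Context {R : realType}.
Local Notation C := R[i].

Record bimodule (U : banachAlgType C) (X : normedModType C) := Bimodule {
  lact : bbilin U X X ;
  ract : bbilin X U X ;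
  lactA : forall a b x, lact (a ** b) x = lact a (lact b x) ;
  ractA : forall x a b, ract x (a ** b) = ract (ract x a) b ;
  lractA : forall a x b, ract (lact a x) b = lact a (ract x b) }.

Definition regular_bimodule (A : banachAlgType C) : bimodule A A :=
  @Bimodule A A (bmulB A) (bmulB A)
    (fun a b x => esym (bmulA a b x)) (fun x a b => bmulA x a b)
    (fun a x b => esym (bmulA a x b)).

Definition bimodule_morphism (U : banachAlgType C) (X Y : normedModType C)
    (M : bimodule U X) (N : bimodule U Y) (f : X -> Y) : Prop :=
  (forall a x, f (lact M a x) = lact N a (f x)) /\
  (forall a x, f (ract M x a) = ract N (f x) a).

Definition compatible (U A : banachAlgType C) (M : bimodule U A) : Prop :=
  (forall alpha a b, lact M alpha (a ** b) = lact M alpha a ** b) /\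
  (forall alpha a b, ract M (a ** b) alpha = a ** ract M b alpha).

Definition left_trivial (U X : banachAlgType C) (M : bimodule U X) : Prop :=
  exists f : blin U C^o, forall alpha a, lact M alpha a = f alpha *: a.

Section Partial.
Context (X : normedModType C).

Lemma bbilinl_subproof (Y Z : normedModType C) (B : bbilin X Y Z) (y : Y) :
  (B ^~ y) \in @blin_pred _ X Z.
Proof.
have [K K0 BK] := bbilin_bounded B.
apply: (@is_blin _ _ _ _ (K * rnorm y)) => [|x]; first exact: bbilin_linearl.
by rewrite -mulrA [rnorm y * _]mulrC BK.
Qed.

Definition bbilinl (Y Z : normedModType C) (B : bbilin X Y Z) (y : Y) :
  blin X Z := Blin (bbilinl_subproof B y).

Lemma bbilinr_subproof (Y Z : normedModType C) (B : bbilin X Y Z) (x : X) :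
  B x \in @blin_pred _ Y Z.
Proof.
have [K K0 BK] := bbilin_bounded B.
apply: (@is_blin _ _ _ _ (K * rnorm x)) => [|y]; first exact: bbilin_linearr.
by rewrite -mulrA BK.
Qed.

Definition bbilinr (Y Z : normedModType C) (B : bbilin X Y Z) (x : X) :
  blin Y Z := Blin (bbilinr_subproof B x).

End Partial.

Section DualBimodule.
Context (U : banachAlgType C) (X : normedModType C) (M : bimodule U X).

Definition dual_lact_fun (a : U) (phi : dual X) : dual X :=
  blin_comp phi (bbilinl (ract M) a).

Definition dual_ract_fun (phi : dual X) (a : U) : dual X :=
  blin_comp phi (bbilinr (lact M) a).

Lemma dual_lact_linearl phi : linear (dual_lact_fun ^~ phi).
Proof. by move=> k a b; apply: blin_eqP => x /=; rewrite bbilin_linearr linearP. Qed.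

Lemma dual_lact_linearr a : linear (dual_lact_fun a).
Proof. by move=> k phi psi; apply: blin_eqP => x. Qed.

Lemma dual_lact_bounded : exists2 K : R, 0 <= K &
  forall a phi, rnorm (dual_lact_fun a phi) <= K * (rnorm a * rnorm phi).
Proof.
have [K K0 MK] := bbilin_bounded (ract M); exists K => // a phi.
rewrite rnorm_blin; apply: opnorm_le => [|x].
  by rewrite !mulr_ge0 ?rnorm_ge0.
rewrite (le_trans (opnorm_bound phi _))//=.
have -> : K * (rnorm a * rnorm phi) * rnorm x =
    opnorm phi * (K * (rnorm x * rnorm a)) by rewrite rnorm_blin; ring.
by rewrite ler_wpM2l ?opnorm_ge0.
Qed.

Lemma dual_ract_linearl a : linear (dual_ract_fun ^~ a).
Proof. by move=> k phi psi; apply: blin_eqP => x. Qed.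

Lemma dual_ract_linearr phi : linear (dual_ract_fun phi).
Proof. by move=> k a b; apply: blin_eqP => x /=; rewrite bbilin_linearl linearP. Qed.

Lemma dual_ract_bounded : exists2 K : R, 0 <= K &
  forall phi a, rnorm (dual_ract_fun phi a) <= K * (rnorm phi * rnorm a).
Proof.
have [K K0 MK] := bbilin_bounded (lact M); exists K => // phi a.
rewrite rnorm_blin; apply: opnorm_le => [|x].
  by rewrite !mulr_ge0 ?rnorm_ge0.
rewrite (le_trans (opnorm_bound phi _))//=.
have -> : K * (rnorm phi * rnorm a) * rnorm x =
    opnorm phi * (K * (rnorm a * rnorm x)) by rewrite rnorm_blin; ring.
by rewrite ler_wpM2l ?opnorm_ge0.
Qed.

Definition dual_lact : bbilin U (dual X) (dual X) :=
  BBilin dual_lact_linearl dual_lact_linearr dual_lact_bounded.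

Definition dual_ract : bbilin (dual X) U (dual X) :=
  BBilin dual_ract_linearl dual_ract_linearr dual_ract_bounded.

Lemma dual_lactA a b phi :
  dual_lact (a ** b) phi = dual_lact a (dual_lact b phi).
Proof. by apply: blin_eqP => x /=; rewrite ractA. Qed.

Lemma dual_ractA phi a b :
  dual_ract phi (a ** b) = dual_ract (dual_ract phi a) b.
Proof. by apply: blin_eqP => x /=; rewrite lactA. Qed.

Lemma dual_lractA a phi b :
  dual_ract (dual_lact a phi) b = dual_lact a (dual_ract phi b).
Proof. by apply: blin_eqP => x /=; rewrite lractA. Qed.

Definition dual_bimodule : bimodule U (dual X) :=
  Bimodule dual_lactA dual_ractA dual_lractA.

End DualBimodule.

Section QuotientBimodule.
Context (U : banachAlgType C) (X : normedModType C) (M : bimodule U X).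
Context (N : closed_subspace X).

Definition invariant : Prop :=
  forall a x, N x -> N (lact M a x) /\ N (ract M x a).

Hypothesis MN : invariant.

Lemma quot_lact_kernel a x : N x -> qproj N (lact M a x) = 0.
Proof.
move=> Nx; rewrite -(linear0 (qproj N)); apply/qpi_eq; rewrite subr0.
by have [] := MN a Nx.
Qed.

Lemma quot_ract_kernel a x : N x -> qproj N (ract M x a) = 0.
Proof.
move=> Nx; rewrite -(linear0 (qproj N)); apply/qpi_eq; rewrite subr0.
by have [] := MN a Nx.
Qed.

Definition quot_lact_fun (a : U) (Q : quotient N) : quotient N :=
  qlift (f := blin_comp (qproj N) (bbilinr (lact M) a)) (quot_lact_kernel a) Q.

Definition quot_ract_fun (Q : quotient N) (a : U) : quotient N :=
  qlift (f := blin_comp (qproj N) (bbilinl (ract M) a)) (quot_ract_kernel a) Q.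

Lemma quot_lact_funE a x : quot_lact_fun a (qpi N x) = qpi N (lact M a x).
Proof. exact: qliftE. Qed.

Lemma quot_ract_funE a x : quot_ract_fun (qpi N x) a = qpi N (ract M x a).
Proof. exact: qliftE. Qed.

Lemma quot_lact_linearl Q : linear (quot_lact_fun ^~ Q).
Proof.
have [x <-] := qpi_surj Q => k a b.
by rewrite /= !quot_lact_funE bbilin_linearl linearP.
Qed.

Lemma quot_lact_linearr a : linear (quot_lact_fun a).
Proof. by move=> k P Q; exact: linearP. Qed.

Lemma quot_lact_bounded : exists2 K : R, 0 <= K &
  forall a Q, rnorm (quot_lact_fun a Q) <= K * (rnorm a * rnorm Q).
Proof.
have [K K0 MK] := bbilin_bounded (lact M); exists K => // a Q.
rewrite mulrA; apply: (qlift_fun_bound (f := blin_comp (qproj N) (bbilinr (lact M) a))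
  (quot_lact_kernel a)) => [|x].
  exact: mulr_ge0 K0 (rnorm_ge0 a).
rewrite /= rnorm_quotient (le_trans (qnorm_le _ _))//.
by rewrite -mulrA MK.
Qed.

Lemma quot_ract_linearl a : linear (quot_ract_fun ^~ a).
Proof. by move=> k P Q; exact: linearP. Qed.

Lemma quot_ract_linearr Q : linear (quot_ract_fun Q).
Proof.
have [x <-] := qpi_surj Q => k a b.
by rewrite /= !quot_ract_funE bbilin_linearr linearP.
Qed.

Lemma quot_ract_bounded : exists2 K : R, 0 <= K &
  forall Q a, rnorm (quot_ract_fun Q a) <= K * (rnorm Q * rnorm a).
Proof.
have [K K0 MK] := bbilin_bounded (ract M); exists K => // Q a.
rewrite [rnorm Q * _]mulrC mulrA.
apply: (qlift_fun_bound (f := blin_comp (qproj N) (bbilinl (ract M) a))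
  (quot_ract_kernel a)) => [|x].
  exact: mulr_ge0 K0 (rnorm_ge0 a).
rewrite /= rnorm_quotient (le_trans (qnorm_le _ _))//.
by rewrite -mulrA [rnorm a * _]mulrC MK.
Qed.

Definition quot_lact : bbilin U (quotient N) (quotient N) :=
  BBilin quot_lact_linearl quot_lact_linearr quot_lact_bounded.

Definition quot_ract : bbilin (quotient N) U (quotient N) :=
  BBilin quot_ract_linearl quot_ract_linearr quot_ract_bounded.

Lemma quot_lactA a b Q : quot_lact (a ** b) Q = quot_lact a (quot_lact b Q).
Proof. by have [x <-] := qpi_surj Q; rewrite /= !quot_lact_funE lactA. Qed.

Lemma quot_ractA Q a b : quot_ract Q (a ** b) = quot_ract (quot_ract Q a) b.
Proof. by have [x <-] := qpi_surj Q; rewrite /= !quot_ract_funE ractA. Qed.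

Lemma quot_lractA a Q b :
  quot_ract (quot_lact a Q) b = quot_lact a (quot_ract Q b).
Proof.
have [x <-] := qpi_surj Q.
by rewrite /= quot_lact_funE !quot_ract_funE quot_lact_funE lractA.
Qed.

Definition quot_bimodule : bimodule U (quotient N) :=
  Bimodule quot_lactA quot_ractA quot_lractA.

End QuotientBimodule.

End Bimodule.

Section TensorSquare.
Context {R : realType}.
Local Notation C := R[i].

(* The projective tensor product of A with itself, as a Banach algebra. *)
Record tensor_square (A : banachAlgType C) := TensorSquare {
  tsq :> banachAlgType C ;
  tens : bbilin A A tsq ;
  tens_projective : is_projective_tensor tens ;
  tensM : forall a b c d : A, tens a b ** tens c d = tens (a ** c) (b ** d) }.

Context {A : banachAlgType C} (T : tensor_square A).

Definition tlift (Z : completeNormedModType C) (B : bbilin A A Z) : blin T Z :=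
  s2val (cid2 (tens_lift (tens_projective T) B)).

Lemma tliftE (Z : completeNormedModType C) (B : bbilin A A Z) a b :
  tlift B (tens T a b) = B a b.
Proof. exact: (s2valP (cid2 (tens_lift (tens_projective T) B))). Qed.

Lemma opnorm_tlift (Z : completeNormedModType C) (B : bbilin A A Z) (M : R) :
  0 <= M -> (forall a b, rnorm (B a b) <= M * (rnorm a * rnorm b)) ->
  opnorm (tlift B) <= M.
Proof. exact: (s2valP' (cid2 (tens_lift (tens_projective T) B))). Qed.

Definition omega : blin T A := tlift (bmulB A).

Lemma tens2_linearl (f g : blin A A) b :
  linear ((fun a b => tens T (f a) (g b)) ^~ b).
Proof. by move=> k a a'; rewrite /= linearP bbilin_linearl. Qed.

Lemma tens2_linearr (f g : blin A A) a :
  linear ((fun a b => tens T (f a) (g b)) a).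
Proof. by move=> k b b'; rewrite /= linearP bbilin_linearr. Qed.

Lemma tens2_le (f g : blin A A) a b : rnorm (tens T (f a) (g b)) <=
  (opnorm f * opnorm g) * (rnorm a * rnorm b).
Proof.
rewrite (le_trans (tens_contraction (tens_projective T) _ _))// mulrACA.
by rewrite ler_pM ?rnorm_ge0 ?opnorm_bound.
Qed.

Lemma tens2_bounded (f g : blin A A) : exists2 M : R, 0 <= M &
  forall a b, rnorm (tens T (f a) (g b)) <= M * (rnorm a * rnorm b).
Proof.
exists (opnorm f * opnorm g); first by rewrite mulr_ge0 ?opnorm_ge0.
exact: tens2_le.
Qed.

Definition tens2 (f g : blin A A) : bbilin A A T :=
  BBilin (@tens2_linearl f g) (@tens2_linearr f g) (tens2_bounded f g).

Lemma idfun_blin : id \in @blin_pred _ A A.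
Proof. by apply: (@is_blin _ _ _ _ 1) => // x; rewrite mul1r. Qed.

Definition blin_id : blin A A := Blin idfun_blin.

Lemma opnorm_id_le : opnorm blin_id <= 1.
Proof. by apply: opnorm_le => // x; rewrite mul1r. Qed.

Section Actions.
Context {U : banachAlgType C} (M : bimodule U A).

(* a . (b (x) c) = (a . b) (x) c  and  (b (x) c) . a = b (x) (c . a) *)
Definition tens_lact_fun (a : U) : T -> T :=
  tlift (tens2 (bbilinr (lact M) a) blin_id).

Definition tens_ract_fun (u : T) (a : U) : T :=
  tlift (tens2 blin_id (bbilinl (ract M) a)) u.

Lemma tens_lact_funE a b c :
  tens_lact_fun a (tens T b c) = tens T (lact M a b) c.
Proof. exact: tliftE. Qed.

Lemma tens_ract_funE a b c :
  tens_ract_fun (tens T b c) a = tens T b (ract M c a).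
Proof. exact: tliftE. Qed.

Lemma tens_lact_linearl u : linear (tens_lact_fun ^~ u).
Proof.
move=> k a a'; rewrite /tens_lact_fun.
pose F (a : U) := tlift (tens2 (bbilinr (lact M) a) blin_id).
suff -> : tlift (tens2 (bbilinr (lact M) (k *: a + a')) blin_id) =
    k *: F a + F a' by [].
apply: (tens_uniq (tens_projective T)) => b c /=.
rewrite !tliftE/= (bbilin_linearl (lact M)) (bbilin_linearl (tens T)).
by rewrite -[RHS]/(k *: F a (tens T b c) + F a' (tens T b c)) /F !tliftE.
Qed.

Lemma tens_lact_linearr a : linear (tens_lact_fun a).
Proof. by move=> k u v; rewrite /tens_lact_fun linearP. Qed.

Lemma tens_lact_bounded : exists2 K : R, 0 <= K &
  forall a u, rnorm (tens_lact_fun a u) <= K * (rnorm a * rnorm u).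
Proof.
have [K K0 MK] := bbilin_bounded (lact M); exists K => // a u.
rewrite (le_trans (opnorm_bound _ _))// mulrA ler_wpM2r ?rnorm_ge0//.
apply: opnorm_tlift => [|b c /=]; first exact: mulr_ge0 K0 (rnorm_ge0 a).
rewrite (le_trans (tens_contraction (tens_projective T) _ _))// mulrA.
by rewrite ler_wpM2r ?rnorm_ge0// -mulrA MK.
Qed.

Lemma tens_ract_linearl a : linear (tens_ract_fun ^~ a).
Proof. by move=> k u v; rewrite /tens_ract_fun linearP. Qed.

Lemma tens_ract_linearr u : linear (tens_ract_fun u).
Proof.
move=> k a a'; rewrite /tens_ract_fun.
pose F (a : U) := tlift (tens2 blin_id (bbilinl (ract M) a)).
suff -> : tlift (tens2 blin_id (bbilinl (ract M) (k *: a + a'))) =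
    k *: F a + F a' by [].
apply: (tens_uniq (tens_projective T)) => b c /=.
rewrite !tliftE/= (bbilin_linearr (ract M)) (bbilin_linearr (tens T)).
by rewrite -[RHS]/(k *: F a (tens T b c) + F a' (tens T b c)) /F !tliftE.
Qed.

Lemma tens_ract_bounded : exists2 K : R, 0 <= K &
  forall u a, rnorm (tens_ract_fun u a) <= K * (rnorm u * rnorm a).
Proof.
have [K K0 MK] := bbilin_bounded (ract M); exists K => // u a.
rewrite [rnorm u * _]mulrC mulrA.
rewrite (le_trans (opnorm_bound _ _))// ler_wpM2r ?rnorm_ge0//.
apply: opnorm_tlift => [|b c /=]; first exact: mulr_ge0 K0 (rnorm_ge0 a).
rewrite (le_trans (tens_contraction (tens_projective T) _ _))//.
rewrite [leRHS]mulrCA ler_wpM2l ?rnorm_ge0// -mulrA [rnorm a * _]mulrC MK//.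
Qed.

Definition tens_lact : bbilin U T T :=
  BBilin tens_lact_linearl tens_lact_linearr tens_lact_bounded.

Definition tens_ract : bbilin T U T :=
  BBilin tens_ract_linearl tens_ract_linearr tens_ract_bounded.

Lemma tens_lactA a b u : tens_lact (a ** b) u = tens_lact a (tens_lact b u).
Proof.
suff : bbilinr tens_lact (a ** b) =
    blin_comp (bbilinr tens_lact a) (bbilinr tens_lact b).
  by move/(congr1 (fun f : blin T T => f u)).
apply: (tens_uniq (tens_projective T)) => c d /=.
by rewrite !tens_lact_funE lactA.
Qed.

Lemma tens_ractA u a b : tens_ract u (a ** b) = tens_ract (tens_ract u a) b.
Proof.
suff : bbilinl tens_ract (a ** b) =
    blin_comp (bbilinl tens_ract b) (bbilinl tens_ract a).
  by move/(congr1 (fun f : blin T T => f u)).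
apply: (tens_uniq (tens_projective T)) => c d /=.
by rewrite !tens_ract_funE ractA.
Qed.

Lemma tens_lractA a u b :
  tens_ract (tens_lact a u) b = tens_lact a (tens_ract u b).
Proof.
suff : blin_comp (bbilinl tens_ract b) (bbilinr tens_lact a) =
    blin_comp (bbilinr tens_lact a) (bbilinl tens_ract b).
  by move/(congr1 (fun f : blin T T => f u)).
apply: (tens_uniq (tens_projective T)) => c d /=.
by rewrite !(tens_lact_funE, tens_ract_funE).
Qed.

Definition tens_bimodule : bimodule U T :=
  Bimodule tens_lactA tens_ractA tens_lractA.

Definition ideal_I : closed_subspace T :=
  closed_ideal_gen [set u | exists alpha a b,
    u = tens T (lact M alpha a) b - tens T a (ract M b alpha)].

Definition ideal_J : closed_subspace A := closed_ideal_gen (omega @` ideal_I).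

Lemma omega_IJ u : ideal_I u -> qproj ideal_J (omega u) = 0.
Proof.
move=> Iu; rewrite -(linear0 (qproj ideal_J)); apply/qpi_eq; rewrite subr0.
by apply: sub_closed_ideal_gen; exists u.
Qed.

Definition omega_tilde : blin (quotient ideal_I) (quotient ideal_J) :=
  qlift (f := blin_comp (qproj ideal_J) omega) omega_IJ.

Lemma omega_tildeE a b :
  omega_tilde (qpi ideal_I (tens T a b)) = qpi ideal_J (a ** b).
Proof. by rewrite /omega_tilde qliftE /= tliftE. Qed.

End Actions.

Definition biflat : Prop :=
  exists theta : blin (dual T) (dual A),
    (forall psi, theta (adjoint omega psi) = psi) /\
    bimodule_morphism (dual_bimodule (tens_bimodule (regular_bimodule A)))
      (dual_bimodule (regular_bimodule A)) theta.

(* The four invariance properties say that the actions of U and A on the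
   quotients by ideal_I and ideal_J are well defined. *)
Definition module_biflat {U : banachAlgType C} (M : bimodule U A) : Prop :=
  let I := ideal_I M in
  let J := ideal_J M in
  exists (UI : invariant (tens_bimodule M) I) (UJ : invariant M J)
    (AI : invariant (tens_bimodule (regular_bimodule A)) I)
    (AJ : invariant (regular_bimodule A) J)
    (theta : dual (quotient I) -> dual (quotient J)),
    [/\ continuous theta,
        {morph theta : phi psi / phi + psi},
        (exists K : R, forall phi, rnorm (theta phi) <= K * rnorm phi),
        (forall psi, theta (adjoint (omega_tilde M) psi) = psi) &
        bimodule_morphism (dual_bimodule (quot_bimodule UI))
          (dual_bimodule (quot_bimodule UJ)) theta /\
        bimodule_morphism (dual_bimodule (quot_bimodule AI))
          (dual_bimodule (quot_bimodule AJ)) theta].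

End TensorSquare.

(* Main.v *)
Require Import Defs.
From HB Require Import structures.
From mathcomp Require Import all_boot all_order all_algebra complex.
From mathcomp Require Import all_classical all_reals topology normedtype.

(** Write [I] and [J] for the two closed ideals of the statement, and [f] for
    the functional through which the acting algebra [U] acts on [A] from the
    left.  Given a bimodule left inverse [theta] of the adjoint of [omega], the
    left inverse required over [U] is [theta] itself, restricted to the
    functionals that vanish on [I] (the dual of the quotient by [I]); the point
    is that [theta] sends them to functionals that vanish on [J]
    ([theta_ideal_J]).

    The left identity of [A/J] enters through the density of the span of
    the products [ab] in [A] ([mul_dense]): if [e] represents it then
    [x = ex - (ex - x)], where [ex] is a product and [ex - x] lies in [J], which
    is contained in the closed span of the products.

    Let [E] be the set of those [y] such that every [x (x) y] lies in [I]
    ([right_leg]).  As [U] acts by scalars from the left, the generators of [I]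
    are the tensors [a (x) (f(alpha) b - b.alpha)], and their right factors lie
    in [E]: moving the scalar across the tensor turns [x (x) (f(alpha) b -
    b.alpha)] into a generator again.  Density of the products shows that [I] is
    stable under the two actions of [A] ([ideal_I_invariant]), hence that [E] is
    an ideal of [A] ([right_leg_ideal]); so [I] lies in the closed span of
    [A (x) E] ([ideal_I_sub_span]).  If [phi] vanishes on [I] and [y] lies in
    [E], then [y.phi] sends [b (x) c] to [phi (b (x) cy) = 0], so that
    [y.theta(phi) = theta(y.phi) = 0], which says that [theta(phi)] vanishes on
    [Ay].  Hence the common kernel of these [theta(phi)] contains [omega(I)]; it
    is a closed ideal since [I] is stable under [A], and so it contains [J].

    Finally [alpha.u - u.alpha] lies in [I] for all [u] ([ideal_I_balanced]) and
    similarly in [J] for [A] ([ideal_J_balanced]), so on both quotients, and on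
    their duals, [U] acts from either side through the scalars [f(alpha)].  Being
    linear, the restricted [theta] commutes with these actions.

    All identities on the tensor square are checked on elementary tensors.  The
    universal property gives this only for maps into Banach spaces, whereas
    quotients and membership in [I] require that a closed subspace containing
    the elementary tensors be everything ([tens_dense]). *)

Set Implicit Arguments.
Unset Strict Implicit.
Unset Printing Implicit Defensive.

Import Order.TTheory GRing.Theory Num.Theory.
Import numFieldTopology.Exports numFieldNormedType.Exports.

Local Open Scope classical_set_scope.
Local Open Scope ring_scope.
Local Open Scope complex_scope.

(** * Closed subspaces of a Banach space are Banach spaces *)

Section SubBanach.
Context {R : realType}.
Local Notation C := R[i].
Context {X : completeNormedModType C} (N : closed_subspace X).

Lemma csub_submod_closed : submod_closed (csub_pred N).
Proof.
split; first exact/asboolP/csub0.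
by move=> k x y /asboolP Nx /asboolP Ny; apply/asboolP/csubP.
Qed.

Record subspace :=
  Subspace { subspace_val : X ; subspace_valP : subspace_val \in csub_pred N }.

HB.instance Definition _ := [isSub for subspace_val].
HB.instance Definition _ := [Choice of subspace by <:].
HB.instance Definition _ :=
  GRing.isSubmodClosed.Build C X (csub_pred N) csub_submod_closed.
HB.instance Definition _ := [SubChoice_isSubLmodule of subspace by <:].

Let norm (x : subspace) : C := `|val x|.

Let ler_normD x y : norm (x + y) <= norm x + norm y.
Proof. by rewrite /norm linearD ler_normD. Qed.

Let normrZ (k : C) x : norm (k *: x) = `|k| * norm x.
Proof. by rewrite /norm linearZ normrZ. Qed.

Let normr0_eq0 x : norm x = 0 -> x = 0.
Proof. by move=> /normr0_eq0 x0; apply: val_inj. Qed.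

HB.instance Definition _ :=
  Lmodule_isNormed.Build C subspace ler_normD normrZ normr0_eq0.

Lemma subspace_val_linear : linear subspace_val.
Proof. by move=> k x y; rewrite -[LHS]/(val (k *: x + y)) linearP. Qed.

Lemma subspace_val_blin : subspace_val \in @blin_pred _ subspace X.
Proof.
by apply: (@is_blin _ _ _ _ 1 subspace_val_linear) => x; rewrite mul1r.
Qed.

Lemma subspace_cauchy_cvg (F : set_system subspace) :
  ProperFilter F -> cauchy F -> cvg F.
Proof.
move=> FF /cauchy_ballP Fc.
have FF' : ProperFilter (subspace_val @ F) by exact: fmap_proper_filter.
have /cauchy_cvg/cvg_ex[x /fcvg_ballP Fx] : cauchy (subspace_val @ F).
  apply/(cauchy_ballP (subspace_val @ F)) => e /Fc [[P Q] /= [FP FQ] PQe].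
  exists (subspace_val @` P, subspace_val @` Q) => /=.
    by split; [apply: filterS FP|apply: filterS FQ] => u ?; exists u.
  move=> [_ _] /= [[u Pu <-] [v Qv <-]].
  by have := PQe (u, v) (conj Pu Qv); rewrite /= -!ball_normE.
have /asboolP Nx : N x.
  apply: (csub_closed (c := N)) => B /nbhs_ballP[e /= e0 xB].
  have [u xu] := @filter_ex _ F FF _ (Fx e e0); exists (subspace_val u).
  by split; [have /asboolP := subspace_valP u|exact: xB].
apply/cvg_ex; exists (Subspace Nx); apply/fcvg_ballP => e /Fx Fe.
by apply: (@filterS _ F _ _ _ _ Fe) => u; rewrite /= -!ball_normE.
Qed.

HB.instance Definition _ :=
  Uniform_isComplete.Build subspace subspace_cauchy_cvg.

End SubBanach.

(** * Constructions of closed subspaces *)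

Section ClosedSubspaces.
Context {R : realType}.
Local Notation C := R[i].

Lemma csubB (X : normedModType C) (N : closed_subspace X) x y :
  N x -> N y -> N (x - y).
Proof. by move=> Nx Ny; rewrite addrC -scaleN1r; exact: csubP. Qed.

Lemma csubZ (X : normedModType C) (N : closed_subspace X) k x :
  N x -> N (k *: x).
Proof. by move=> Nx; rewrite -[_ *: _]addr0; apply: csubP => //; exact: csub0. Qed.

Section Preimage.
Context (X Y : normedModType C) (f : blin X Y) (N : closed_subspace Y).

Lemma csub_preim0 : N (f 0).
Proof. by rewrite linear0; exact: csub0. Qed.

Lemma csub_preimP (k : C) x y : N (f x) -> N (f y) -> N (f (k *: x + y)).
Proof. by rewrite linearP; exact: csubP. Qed.

Lemma csub_preim_closed : closed ([set x | N (f x)]).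
Proof.
by apply: (preimage_closed (f := f)) (@csub_closed _ _ N) => x _; exact: blin_continuous.
Qed.

Definition csub_preim : closed_subspace X :=
  ClosedSubspace csub_preim0 csub_preimP csub_preim_closed.

End Preimage.

Section Intersection.
Context (X : normedModType C) (I : Type) (N : I -> closed_subspace X).

Lemma csub_cap0 i : N i 0.
Proof. exact: csub0. Qed.

Lemma csub_capP (k : C) x y :
  (forall i, N i x) -> (forall i, N i y) -> forall i, N i (k *: x + y).
Proof. by move=> Nx Ny i; exact: csubP. Qed.

Lemma csub_cap_closed : closed ([set x | forall i, N i x]).
Proof.
move=> x clx i; apply: (csub_closed (c := N i)) => B /clx[y [Ny By]].
by exists y.
Qed.

Definition csub_cap : closed_subspace X :=
  ClosedSubspace csub_cap0 csub_capP csub_cap_closed.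

End Intersection.

Definition csub_meet (X : normedModType C) (N P : closed_subspace X) :=
  csub_cap (fun b : bool => if b then N else P).

Lemma csub_meetP (X : normedModType C) (N P : closed_subspace X) x :
  csub_meet N P x <-> N x /\ P x.
Proof.
split=> [NPx|[Nx Px] []//]; split; [exact: (NPx true)|exact: (NPx false)].
Qed.

Section Kernel.
Context (X Y : normedModType C) (f : blin X Y).

Lemma csub_ker0 : f 0 = 0.
Proof. exact: linear0. Qed.

Lemma csub_kerP (k : C) x y : f x = 0 -> f y = 0 -> f (k *: x + y) = 0.
Proof. by move=> fx fy; rewrite linearP/= fx fy scaler0 addr0. Qed.

Lemma csub_ker_closed : closed ([set x | f x = 0]).
Proof.
apply: (preimage_closed (f := f) (D := [set 0])).
  by move=> x _; exact: blin_continuous.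
apply: accessible_closed_set1; apply: hausdorff_accessible.
exact: norm_hausdorff.
Qed.

Definition csub_ker : closed_subspace X :=
  ClosedSubspace csub_ker0 csub_kerP csub_ker_closed.

End Kernel.

Definition closed_span (X : normedModType C) (S : set X) : closed_subspace X :=
  csub_cap (fun N : {N : closed_subspace X | S `<=` N} => sval N).

Lemma closed_span_ind (X : normedModType C) (S : set X)
  (N : closed_subspace X) : S `<=` N -> forall x, closed_span S x -> N x.
Proof. by move=> SN x /(_ (exist _ N SN)). Qed.

Lemma sub_closed_span (X : normedModType C) (S : set X) : S `<=` closed_span S.
Proof. by move=> x Sx [N SN]; exact: SN. Qed.

End ClosedSubspaces.

(** * Density of the elementary tensors *)

Section Density.
Context {R : realType}.
Local Notation C := R[i].
Context {A : banachAlgType C} (T : tensor_square A).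

(** The tensor map corestricts to the Banach space [N], so it lifts to a map
    from the tensor square to [N].  Followed by the inclusion of [N], that lift
    agrees with the identity on elementary tensors, hence everywhere: [N] is
    the whole space. *)
Lemma tens_dense (N : closed_subspace T) :
  (forall a b, N (tens T a b)) -> forall u, N u.
Proof.
move=> Ntens; pose B a b := Subspace (asboolT (Ntens a b)).
have Bl b : linear (B ^~ b).
  by move=> k x y; apply: val_inj; rewrite linearP/= bbilin_linearl.
have Br a : linear (B a).
  by move=> k x y; apply: val_inj; rewrite linearP/= bbilin_linearr.
have [b0 b0_ge0 Bb] := bbilin_bounded (tens T).
pose L := tlift T (BBilin Bl Br (ex_intro2 _ _ b0 b0_ge0 Bb)).
have incl : blin_comp (Blin (subspace_val_blin N)) L = blin_id.
  by apply: (tens_uniq (tens_projective T)) => a b /=; rewrite tliftE.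
move=> u; rewrite -[u]/(blin_id u) -incl.
by have /asboolP := subspace_valP (L u).
Qed.

(** Unlike the uniqueness clause of the universal property, this holds for a
    target that need not be complete, such as a quotient. *)
Lemma tens_ext (Y : normedModType C) (f g : blin T Y) :
  (forall a b, f (tens T a b) = g (tens T a b)) -> f =1 g.
Proof.
move=> fg u; apply/eqP; rewrite -subr_eq0; apply/eqP.
apply: (tens_dense (N := csub_ker (f - g))) => a b.
by apply/eqP; rewrite subr_eq0; apply/eqP/fg.
Qed.

(** The closed span of [A (x) E] is an ideal as multiplication by an elementary
    tensor acts on the right factors inside [E], and elementary tensors are
    dense. *)
Lemma closed_span_tens_ideal (E : closed_subspace A) : is_ideal E ->
  is_ideal (closed_span [set u | exists a e, E e /\ u = tens T a e]).
Proof.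
move=> EI v x; set H := closed_span _.
have H0 a e : E e -> H (tens T a e).
  by move=> Ee; apply: sub_closed_span; exists a, e.
move=> Hx; split.
- apply: (closed_span_ind (N := csub_preim (bbilinr (bmulB T) v) H)) Hx.
  move=> _ [a [e [Ee ->]]] /=.
  apply: (tens_dense (N := csub_preim (bbilinl (bmulB T) (tens T a e)) H)).
  by move=> b c; rewrite /= tensM; apply: H0; have [] := EI c e Ee.
- apply: (closed_span_ind (N := csub_preim (bbilinl (bmulB T) v) H)) Hx.
  move=> _ [a [e [Ee ->]]] /=.
  apply: (tens_dense (N := csub_preim (bbilinr (bmulB T) (tens T a e)) H)).
  by move=> b c; rewrite /= tensM; apply: H0; have [] := EI c e Ee.
Qed.

End Density.

(** * Multiplication and the actions on the tensor square *)

Section Bilinear.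
Context {R : realType}.
Local Notation C := R[i].
Context (X Y Z : normedModType C) (B : bbilin X Y Z).

Lemma bbilinZl k x y : B (k *: x) y = k *: B x y.
Proof. by rewrite -[LHS]/(bbilinl B y _) linearZ. Qed.

Lemma bbilinZr k x y : B x (k *: y) = k *: B x y.
Proof. by rewrite -[LHS]/(bbilinr B x _) linearZ. Qed.

Lemma bbilinBr x y y' : B x (y - y') = B x y - B x y'.
Proof. by rewrite -[LHS]/(bbilinr B x _) linearB. Qed.

End Bilinear.

Section TensorActions.
Context {R : realType}.
Local Notation C := R[i].
Context {A : banachAlgType C} (T : tensor_square A).
Local Notation AT := (tens_bimodule T (regular_bimodule A)).

Section Elementary.
Context {U : banachAlgType C} (M : bimodule U A).

Lemma tens_lactE alpha b c :
  lact (tens_bimodule T M) alpha (tens T b c) = tens T (lact M alpha b) c.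
Proof. exact: tens_lact_funE. Qed.

Lemma tens_ractE alpha b c :
  ract (tens_bimodule T M) (tens T b c) alpha = tens T b (ract M c alpha).
Proof. exact: tens_ract_funE. Qed.

End Elementary.

(** [a.(uv) = (a.u)v], the action touching only the leftmost factor; with
    [tens_ract_mul], this reduces the stability of the ideal [I] under the
    actions of [A] to its generators. *)
Lemma tens_lact_mul a (u v : T) : lact AT a (u ** v) = lact AT a u ** v.
Proof.
pose f v := bbilinl (bmulB T) v.
pose g := bbilinr (lact AT) a.
pose h u := bbilinr (bmulB T) u.
apply: (tens_ext (f := blin_comp g (f v)) (g := blin_comp (f v) g)) => b c /=.
apply: (tens_ext (f := blin_comp g (h (tens T b c)))
  (g := h (lact AT a (tens T b c)))) => d e /=.
by rewrite tensM !tens_lact_funE tensM /= bmulA.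
Qed.

Lemma tens_ract_mul a (u v : T) : ract AT (u ** v) a = u ** ract AT v a.
Proof.
pose f v := bbilinl (bmulB T) v.
pose g := bbilinl (ract AT) a.
pose h u := bbilinr (bmulB T) u.
apply: (tens_ext (f := blin_comp g (f v)) (g := f (ract AT v a))) => b c /=.
apply: (tens_ext (f := blin_comp g (h (tens T b c)))
  (g := blin_comp (h (tens T b c)) g)) => d e /=.
by rewrite tensM !tens_ract_funE tensM /= bmulA.
Qed.

End TensorActions.

(** * Bimodules on which an algebra acts through scalars modulo a subspace *)

Section ScalarDualAction.
Context {R : realType}.
Local Notation C := R[i].
Context {U : banachAlgType C} {X : normedModType C} (M : bimodule U X).
Context (N : closed_subspace X) (f : U -> C).
Hypothesis lactE : forall alpha x, lact M alpha x = f alpha *: x.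
Hypothesis ractE : forall alpha x, N (lact M alpha x - ract M x alpha).

Lemma scalar_balanced_invariant : Defs.invariant M N.
Proof.
move=> alpha x Nx; have Nl : N (lact M alpha x) by rewrite lactE; exact: csubZ.
by split=> //; rewrite -[ract _ _ _](subKr (lact M alpha x)); exact: csubB.
Qed.

Context (NU : Defs.invariant M N).
Local Notation D := (dual_bimodule (quot_bimodule NU)).

(** Modulo [N] the right action coincides with the left one, which is scalar. *)
Lemma dual_quot_lact_scalar alpha phi : lact D alpha phi = f alpha *: phi.
Proof.
apply: blin_eqP => Q; have [x <-] := qpi_surj Q.
rewrite /= /quot_ract_fun qliftE/=.
have /qpi_eq <- := ractE alpha x.
by rewrite lactE !linearZ.
Qed.

Lemma dual_quot_ract_scalar alpha phi : ract D phi alpha = f alpha *: phi.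
Proof.
apply: blin_eqP => Q; have [x <-] := qpi_surj Q.
by rewrite /= /quot_lact_fun qliftE/= lactE !linearZ.
Qed.

End ScalarDualAction.

(** * The ideals [I] and [J] *)

Section Ideals.
Context {R : realType}.
Local Notation C := R[i].
Context {A U : banachAlgType C} (M : bimodule U A) (T : tensor_square A).
Local Notation I := (ideal_I T M).
Local Notation J := (ideal_J T M).
Local Notation AT := (tens_bimodule T (regular_bimodule A)).
Local Notation UT := (tens_bimodule T M).

Lemma ideal_I_ideal : is_ideal I. Proof. exact: closed_ideal_gen_ideal. Qed.
Lemma ideal_J_ideal : is_ideal J. Proof. exact: closed_ideal_gen_ideal. Qed.

Lemma ideal_I_gen alpha a b :
  I (tens T (lact M alpha a) b - tens T a (ract M b alpha)).
Proof. by apply: sub_closed_ideal_gen; exists alpha, a, b. Qed.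

Lemma ideal_J_omega u : I u -> J (omega T u).
Proof. by move=> Iu; apply: sub_closed_ideal_gen; exists u. Qed.

Lemma ideal_I_balanced alpha u : I (lact UT alpha u - ract UT u alpha).
Proof.
apply: (tens_dense (N := csub_preim (bbilinr (lact UT) alpha -
  bbilinl (ract UT) alpha) I)) => a b.
change (I (lact UT alpha (tens T a b) - ract UT (tens T a b) alpha)).
by rewrite tens_lactE tens_ractE; exact: ideal_I_gen.
Qed.

(** For [e] representing the left identity, [x = ex - (ex - x)] with [ex - x] in
    [J], and [J] lies in the closed span of the products since that span is an
    ideal containing the whole range of [omega]. *)
Lemma mul_dense e :
  left_id e (@qmul R A J) ->
  forall N : closed_subspace A, (forall a b, N (a ** b)) -> forall x, N x.
Proof.
have [e0 <-] := qpi_surj e => eJ N Nmul x.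
have Jx : J (e0 ** x - x).
  by apply/qpi_eq; rewrite -(qmulE _ _ ideal_J_ideal) eJ.
suff JN : forall y, J y -> N y.
  by rewrite -[x](subKr (e0 ** x)); apply: csubB => //; exact: JN.
move=> y Jy.
pose S := closed_span [set z | exists a b : A, z = a ** b].
have Smul a b : S (a ** b) by apply: sub_closed_span; exists a, b.
apply: (closed_span_ind (S := [set z | exists a b : A, z = a ** b])).
  by move=> _ [a [b ->]].
apply: (Jy S) => [//|_ [u Iu <-]].
apply: (tens_dense (N := csub_preim (omega T) S)) => a b.
by rewrite /= tliftE; exact: Smul.
Qed.

Hypothesis Mcompat : compatible M.
Hypothesis A2_dense :
  forall N : closed_subspace A, (forall a b, N (a ** b)) -> forall x, N x.
Context (f : U -> C).
Hypothesis Mtriv : forall alpha a, lact M alpha a = f alpha *: a.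

(** On a product [x = ab] this is the image under [omega] of a generator of [I],
    by compatibility of the actions. *)
Lemma ideal_J_balanced alpha x : J (lact M alpha x - ract M x alpha).
Proof.
apply: (A2_dense (N := csub_preim (bbilinr (lact M) alpha -
  bbilinl (ract M) alpha) J)) => a b.
change (J (lact M alpha (a ** b) - ract M (a ** b) alpha)).
rewrite Mcompat.1 Mcompat.2.
have := ideal_J_omega (ideal_I_gen alpha a b).
by rewrite linearB/= !tliftE.
Qed.

Lemma tens_lact_scalar alpha u : lact UT alpha u = f alpha *: u.
Proof.
apply: (tens_ext (f := bbilinr (lact UT) alpha) (g := f alpha *: blin_id)).
move=> a b /=; rewrite tens_lact_funE Mtriv.
by rewrite bbilinZl.
Qed.

(** For [x = pq] this tensor is the product of a generator of [I] with
    [q (x) a]; products are dense. *)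
Lemma ideal_I_tens_mulr alpha x y a : I (tens T x
  ((lact M alpha y - ract M y alpha) ** a)).
Proof.
apply: (A2_dense (N := csub_preim (bbilinl (tens T)
  ((lact M alpha y - ract M y alpha) ** a)) I)) => p q.
change (I (tens T (p ** q) ((lact M alpha y - ract M y alpha) ** a))).
rewrite -tensM; apply: (ideal_I_ideal _ _).2.
rewrite bbilinBr Mtriv bbilinZr -bbilinZl -Mtriv; exact: ideal_I_gen.
Qed.

(** By the second hypothesis, the elements of [I] that [g] maps into [I] form an
    ideal; so it is enough to look at the generators. *)
Lemma ideal_I_stable (g : blin T T) :
  (forall alpha a b,
    I (g (tens T (lact M alpha a) b - tens T a (ract M b alpha)))) ->
  (forall v w, I w -> I (g w) -> I (g (v ** w)) /\ I (g (w ** v))) ->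
  forall u, I u -> I (g u).
Proof.
move=> gen gM u Iu; suff /csub_meetP[] : csub_meet I (csub_preim g I) u by [].
apply: Iu => [v w /csub_meetP[Iw Igw]|_ [alpha [a [b ->]]]].
  have [vw wv] := gM v w Iw Igw.
  split; apply/csub_meetP; split=> //.
    exact: (ideal_I_ideal v Iw).1.
  exact: (ideal_I_ideal v Iw).2.
by apply/csub_meetP; split; [exact: ideal_I_gen|exact: gen].
Qed.

(** The left action maps generators to generators.  The right action does not:
    it multiplies the right factor [f(alpha) b - b.alpha] of a generator, whence
    the need for [ideal_I_tens_mulr]. *)
Lemma ideal_I_invariant : Defs.invariant AT I.
Proof.
move=> a u Iu; split.
  apply: (ideal_I_stable (g := bbilinr (lact AT) a)) Iu => [alpha x y|v w Iw Iaw].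
    change (I (lact AT a (tens T (lact M alpha x) y - tens T x (ract M y alpha)))).
    rewrite bbilinBr !tens_lactE.
    have -> : lact (regular_bimodule A) a (lact M alpha x) = lact M alpha (a ** x).
      by rewrite !Mtriv bbilinZr.
    exact: ideal_I_gen.
  change (I (lact AT a (v ** w)) /\ I (lact AT a (w ** v))).
  rewrite !tens_lact_mul; split; first exact: (ideal_I_ideal _ Iw).1.
  exact: (ideal_I_ideal _ Iaw).2.
apply: (ideal_I_stable (g := bbilinl (ract AT) a)) Iu => [alpha x y|v w Iw Iwa].
  have := ideal_I_tens_mulr alpha x y a.
  congr (I _); rewrite -[RHS]/(bbilinl (ract AT) a _) linearB.
  rewrite -[RHS]/(ract AT _ a - ract AT _ a) !tens_ractE.
  rewrite bmulBl bbilinBr !Mtriv bbilinZl -bbilinZr; congr (tens T x _ - _).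
  exact: (bbilinZl (bmulB A) _ _ _).
change (I (ract AT (v ** w) a) /\ I (ract AT (w ** v) a)).
rewrite !tens_ract_mul; split; first exact: (ideal_I_ideal _ Iwa).1.
exact: (ideal_I_ideal _ Iw).2.
Qed.

Definition right_leg : closed_subspace A :=
  csub_cap (fun x => csub_preim (bbilinr (tens T) x) I).

(** Stability under right multiplication is that of [I]; on the left,
    [pq (x) ay = (p (x) a)(q (x) y)] lies in [I], and products are dense. *)
Lemma right_leg_ideal : is_ideal right_leg.
Proof.
move=> a y Ey; split=> x.
  apply: (A2_dense (N := csub_preim (bbilinl (tens T) (a ** y)) I)) => p q.
  change (I (tens T (p ** q) (a ** y))).
  by rewrite -tensM; apply: (ideal_I_ideal _ _).1; exact: Ey.
change (I (tens T x (ract (regular_bimodule A) y a))).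
by rewrite -tens_ractE; apply: (ideal_I_invariant a _).2; exact: Ey.
Qed.

(** A generator of [I] is [a (x) (alpha.b - b.alpha)] because the left action is
    scalar, and for the same reason its right factor lies in [right_leg]. *)
Lemma ideal_I_sub_span :
  I `<=` closed_span [set u | exists a e, right_leg e /\ u = tens T a e].
Proof.
move=> u; apply; first exact/closed_span_tens_ideal/right_leg_ideal.
move=> _ [alpha [a [b ->]]]; apply: sub_closed_span.
exists a, (lact M alpha b - ract M b alpha).
split=> [x|]; last by rewrite bbilinBr !Mtriv bbilinZr bbilinZl.
change (I (tens T x (lact M alpha b - ract M b alpha))).
by rewrite bbilinBr Mtriv bbilinZr -bbilinZl -Mtriv; exact: ideal_I_gen.
Qed.

(** * The induced left inverse *)

Section LeftInverse.
Context (theta : blin (dual T) (dual A)).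
Hypothesis theta_morph : bimodule_morphism (dual_bimodule AT)
  (dual_bimodule (regular_bimodule A)) theta.

(** Here [y.phi = 0], because it sends [b (x) c] to [phi (b (x) cy)], so that
    [y.theta(phi) = theta(y.phi) = 0]. *)
Lemma theta_right_leg (phi : dual T) a y :
  (forall u, I u -> phi u = 0) -> right_leg y -> theta phi (a ** y) = 0.
Proof.
move=> phiI Ey.
have phiy : lact (dual_bimodule AT) y phi = 0.
  apply: blin_eqP; apply: tens_ext => b c.
  change (phi (ract AT (tens T b c) y) = 0); rewrite tens_ractE; apply: phiI.
  exact: (right_leg_ideal _ Ey).1.
have := theta_morph.1 y phi; rewrite phiy linear0.
by move=> /(congr1 (fun g : dual A => g a))/= /esym.
Qed.

Definition theta_ker : closed_subspace A :=
  csub_cap (fun phi : {phi : dual T | forall u, I u -> phi u = 0} =>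
    csub_ker (theta (sval phi))).

(** The functionals that vanish on [I] form a submodule, since [I] is stable
    under [A], and [theta] is a bimodule morphism. *)
Lemma theta_ker_ideal : is_ideal theta_ker.
Proof.
move=> a x Kx; split=> -[phi phiI].
  have phiaI u : I u -> ract (dual_bimodule AT) phi a u = 0.
    by move=> Iu; apply: phiI; exact: (ideal_I_invariant a Iu).1.
  have : theta (ract (dual_bimodule AT) phi a) x = 0 := Kx (exist _ _ phiaI).
  by rewrite theta_morph.2.
have phiaI u : I u -> lact (dual_bimodule AT) a phi u = 0.
  by move=> Iu; apply: phiI; exact: (ideal_I_invariant a Iu).2.
have : theta (lact (dual_bimodule AT) a phi) x = 0 := Kx (exist _ _ phiaI).
by rewrite theta_morph.1.
Qed.

(** [omega(I)] lies in the closed span of the products [ay] with [y] in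
    [right_leg], all of which are killed; being an ideal, [theta_ker] contains
    the ideal that [omega(I)] generates. *)
Lemma theta_ideal_J (phi : dual T) :
  (forall u, I u -> phi u = 0) -> forall x, J x -> theta phi x = 0.
Proof.
move=> phiI x Jx; suff Kx : theta_ker x by exact: (Kx (exist _ phi phiI)).
apply: Jx => [|_ [u Iu <-]]; first exact: theta_ker_ideal.
apply: (closed_span_ind (N := csub_preim (omega T) theta_ker)) (ideal_I_sub_span Iu).
move=> _ [a [y [Ey ->]]] -[psi psiI] /=.
by rewrite tliftE; exact: theta_right_leg.
Qed.

Lemma comp_qproj_ideal_I (phi : dual (quotient I)) u :
  I u -> blin_comp phi (qproj I) u = 0.
Proof.
move=> Iu; rewrite /= -(linear0 phi); congr (phi _).
by rewrite -(linear0 (qpi I)); apply/qpi_eq; rewrite subr0.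
Qed.

Definition theta_tilde_fun (phi : dual (quotient I)) : dual (quotient J) :=
  qlift (theta_ideal_J (comp_qproj_ideal_I phi)).

Lemma theta_tilde_funE phi x :
  theta_tilde_fun phi (qpi J x) = theta (blin_comp phi (qproj I)) x.
Proof. exact: qliftE. Qed.

Lemma theta_tilde_subproof : theta_tilde_fun \in
  @blin_pred _ (dual (quotient I)) (dual (quotient J)).
Proof.
apply: (@is_blin _ _ _ _ (opnorm theta)) => [k phi psi|phi].
  apply: blin_eqP => Q; have [x <-] := qpi_surj Q.
  rewrite [LHS]theta_tilde_funE.
  rewrite -[RHS]/(k *: theta_tilde_fun phi (qpi J x) +
    theta_tilde_fun psi (qpi J x)).
  rewrite !theta_tilde_funE.
  have -> : blin_comp (k *: phi + psi) (qproj I) =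
      k *: blin_comp phi (qproj I) + blin_comp psi (qproj I) :> dual T.
    exact: blin_eqP.
  by rewrite linearP.
have K0 : 0 <= opnorm theta * rnorm phi.
  exact: mulr_ge0 (opnorm_ge0 _) (rnorm_ge0 _).
rewrite rnorm_blin; apply: opnorm_le => // Q.
apply: (qlift_fun_bound (theta_ideal_J (comp_qproj_ideal_I phi)) K0) => x.
apply: (@le_trans _ _ (opnorm (theta (blin_comp phi (qproj I))) * rnorm x)).
  exact: opnorm_bound.
rewrite ler_wpM2r ?rnorm_ge0//.
apply: (@le_trans _ _ (opnorm theta * rnorm (blin_comp phi (qproj I) : dual T))).
  exact: (opnorm_bound theta (blin_comp phi (qproj I))).
rewrite ler_wpM2l ?opnorm_ge0//.
apply: opnorm_le => [|u]; first exact: opnorm_ge0.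
apply: (@le_trans _ _ (opnorm phi * rnorm (qproj I u))).
  exact: (opnorm_bound phi (qproj I u)).
rewrite ler_wpM2l ?opnorm_ge0//.
exact: qnorm_le.
Qed.

Definition theta_tilde : blin (dual (quotient I)) (dual (quotient J)) :=
  Blin theta_tilde_subproof.

Lemma theta_tildeK : (forall psi, theta (adjoint (omega T) psi) = psi) ->
  forall psi, theta_tilde (adjoint (omega_tilde T M) psi) = psi.
Proof.
move=> thetaK psi; apply: blin_eqP => Q; have [x <-] := qpi_surj Q.
rewrite [LHS]theta_tilde_funE.
suff -> : blin_comp (adjoint (omega_tilde T M) psi) (qproj I) =
    adjoint (omega T) (blin_comp psi (qproj J)) :> dual T by rewrite thetaK.
by apply: blin_eqP => u; apply: (congr1 psi); exact: qliftE.
Qed.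

Lemma theta_tilde_morphism (AI : Defs.invariant AT I)
    (AJ : Defs.invariant (regular_bimodule A) J) :
  bimodule_morphism (dual_bimodule (quot_bimodule AI))
    (dual_bimodule (quot_bimodule AJ)) theta_tilde.
Proof.
split=> a phi; apply: blin_eqP => Q; have [x <-] := qpi_surj Q.
  rewrite [LHS]theta_tilde_funE.
  rewrite -[RHS]/(theta_tilde_fun phi (quot_ract_fun AJ (qpi J x) a)).
  rewrite quot_ract_funE theta_tilde_funE.
  have -> : blin_comp (lact (dual_bimodule (quot_bimodule AI)) a phi) (qproj I) =
      lact (dual_bimodule AT) a (blin_comp phi (qproj I)) :> dual T.
    by apply: blin_eqP => u /=; rewrite quot_ract_funE.
  by rewrite theta_morph.1.
rewrite [LHS]theta_tilde_funE.
rewrite -[RHS]/(theta_tilde_fun phi (quot_lact_fun AJ a (qpi J x))).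
rewrite quot_lact_funE theta_tilde_funE.
have -> : blin_comp (ract (dual_bimodule (quot_bimodule AI)) phi a) (qproj I) =
    ract (dual_bimodule AT) (blin_comp phi (qproj I)) a :> dual T.
  by apply: blin_eqP => u /=; rewrite quot_lact_funE.
by rewrite theta_morph.2.
Qed.

End LeftInverse.

End Ideals.

Theorem proposition2p5 (R : realType) (A U : banachAlgType R[i])
  (M : bimodule U A) (T : tensor_square A) :
  compatible M ->
  left_trivial M ->
  (exists e : quotient (ideal_J T M), left_id e (@qmul R A (ideal_J T M))) ->
  biflat T ->
  module_biflat T M.
Proof.
move=> Mc [f Mtriv] [e eJ] [theta [thetaK theta_morph]].
have A2 := mul_dense eJ.
have Ibal := @ideal_I_balanced _ _ _ M T.
have Jbal := ideal_J_balanced (T := T) Mc A2.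
have Iscal := tens_lact_scalar (T := T) Mtriv.
have UI := scalar_balanced_invariant Iscal Ibal.
have UJ := scalar_balanced_invariant Mtriv Jbal.
have AI := ideal_I_invariant (T := T) A2 Mtriv.
have AJ : Defs.invariant (regular_bimodule A) (ideal_J T M).
  by move=> a x Jx; exact: ideal_J_ideal.
pose tt := theta_tilde A2 Mtriv theta_morph.
exists UI, UJ, AI, AJ, tt; split.
- exact: blin_continuous.
- exact: linearD.
- by exists (opnorm tt) => phi; exact: opnorm_bound.
- exact: theta_tildeK.
- split; last exact: theta_tilde_morphism.
  split=> alpha phi.
    rewrite (dual_quot_lact_scalar Iscal Ibal UI).
    by rewrite (dual_quot_lact_scalar Mtriv Jbal UJ) linearZ.
  rewrite (dual_quot_ract_scalar Iscal UI).
  by rewrite (dual_quot_ract_scalar Mtriv UJ) linearZ.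
Qed.
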